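(* Let $E \subset \mathbb{R}$. Then $E$ is $\operatorname{lip} 1$ if and only if $E=\bigcup_{n=1}^\infty E_n$ where each $E_n\subset\mathbb{R}$ is a strongly one-sided dense closed set.
   Context: For a continuous function $f:\mathbb{R}\to\mathbb{R}$, $x\in\mathbb{R}$ and $r>0$ put $M_f(x,r)=\frac{1}{r}\sup\{|f(x)-f(y)| : |x-y|\le r\}$, and define $\operatorname{lip} f(x)=\liminf_{r\to 0^+} M_f(x,r)$. A set $E\subset\mathbb{R}$ is called $\operatorname{lip} 1$ if there is a continuous function $f:\mathbb{R}\to\mathbb{R}$ such that $\operatorname{lip} f=\mathbf{1}_E$ (the characteristic function of $E$) everywhere on $\mathbb{R}$. Let $|A|$ denote the Lebesgue measure of $A$. A set $E\subset\mathbb{R}$ is strongly one-sided dense at $x$ if for every sequence of positive numbers $r_n\to 0^+$ we have $$\max\Big\{\frac{|E\cap[x-r_n,x]|}{r_n},\frac{|E\cap[x,x+r_n]|}{r_n}\Big\}\to 1.$$ The set $E$ is strongly one-sided dense (SOSD) if it is strongly one-sided dense at every point $x\in E$. (In particular the empty set is vacuously SOSD.) *)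

(* Defs.v *)
(* MathComp-Analysis *)
From mathcomp Require Export all_boot all_order all_algebra.
From mathcomp Require Export all_classical all_reals all_analysis.
Export Order.TTheory GRing.Theory Num.Theory.
Export numFieldNormedType.Exports.

Set Implicit Arguments.
Unset Strict Implicit.
Unset Printing Implicit Defensive.

Local Open Scope classical_set_scope.
Local Open Scope ring_scope.

(* The supremum is taken in \bar R: for continuous f it is finite and is the
   usual real supremum. *)
Definition scaled_osc (R : realType) (f : R -> R) (x r : R) : \bar R :=
  ((r^-1)%:E *
   ereal_sup [set (`|f x - f y|)%R%:E | y in [set y | (`|x - y| <= r)%R]])%E.

(* Extended-real valued: lip f x may be +oo, even for continuous f. *)
Definition lip (R : realType) (f : R -> R) (x : R) : \bar R :=
  limf_einf (scaled_osc f x) 0^'+.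

Definition lip1 (R : realType) (E : set R) : Prop :=
  exists f : R -> R,
    continuous f /\ forall x : R, lip f x = (\1_E x)%:E.

(* On non-measurable sets lebesgue_measure takes the value of the outer
   measure. *)
Definition strongly_one_sided_dense_at (R : realType) (E : set R) (x : R)
    : Prop :=
  forall r : nat -> R, (forall n, 0 < r n) -> r n @[n --> \oo] --> 0 ->
    maxe ((r n)^-1%:E * lebesgue_measure (E `&` `[(x - r n)%R, x]))%E
         ((r n)^-1%:E * lebesgue_measure (E `&` `[x, (x + r n)%R]))%E
      @[n --> \oo] --> 1%:E.

Definition SOSD (R : realType) (E : set R) : Prop :=
  forall x, E x -> strongly_one_sided_dense_at E x.

(* Main.v *)
(** If [lip f] is the indicator of [E] then [f] is 1-Lipschitz, and at a point
    of [E] it climbs with slope nearly [+-1] on one side at every small scale; a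
    rising-sun argument shows that most points of that side keep an oscillation
    [>= s/16] at all scales [s] below a fixed one.  Since [lip f] only takes the
    values 0 and 1, an oscillation bounded below by any fixed multiple of the
    scale already forces membership in [E].  Asking for it only up to cells of
    dyadic grids gives closed sets exhausting [E].  A point inside its cells
    shares all coarse scales with its neighbours, so these sets are strongly
    one-sided dense there; the grid is translated so that each of its points in
    [E] is a Lebesgue density point of a set of uniformly oscillating points.

    Conversely, write [E] as the increasing union of closed strongly one-sided
    dense sets [C n] and let [f] be the sum over [n] of functions with slope
    [+-1] on [C n.+1 `\` C n] and 0 elsewhere, the n-th one bounded by
    [2^-n dist(x, C n)].  At [x] in [C n.+1 `\` C n] one side has slope [+-1];
    at [x] outside [E] the oscillation at scale [dist(x, C n)] is negligible. *)

Require Import Defs.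
From mathcomp Require Import lra measurable_realfun.
Local Open Scope classical_set_scope.
Local Open Scope ring_scope.


Set Implicit Arguments.
Unset Strict Implicit.
Unset Printing Implicit Defensive.

(** * Lower scaled oscillation *)

Section basics.
Context {R : realType}.
Implicit Types (f phi : R -> R) (x y a b c d r : R).

(** Continuous induction: by continuity the supremum of the [t] in [[a, b]] with [phi a <= phi t] is
    itself such a [t], and were it below [b], a step would pass beyond it. *)
Lemma le_of_steps phi a b : a <= b -> continuous phi ->
  (forall t, a <= t -> t < b -> exists2 u, t < u <= b & phi t <= phi u) ->
  phi a <= phi b.
Proof.
move=> ab cphi step.
pose S := [set t | (a <= t <= b) /\ phi a <= phi t].
have Sa : S a by split; rewrite /= ?lexx ?ab.
have Sub : ubound S b by move=> t [/andP[]].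
have supS : has_sup S by split; [exists a | exists b].
have ac : a <= sup S by apply: ub_le_sup => //; exists b.
have cb : sup S <= b by apply: ge_sup => //; exists a.
have Sc : phi a <= phi (sup S).
  rewrite leNgt; apply/negP => lt_c.
  have : \forall t \near sup S, phi t < phi a.
    exact: (cvgr_lt _ (cphi (sup S)) _ lt_c).
  move=> /nbhs_ballP[e /= e0 He].
  have [t [St1 St2] tc] := sup_adherent e0 supS.
  have : ball (sup S) e t.
    rewrite /ball /= ger0_norm; first by rewrite ltrBlDr -ltrBlDl.
    by rewrite subr_ge0; apply: ub_le_sup => //; exists b.
  by move=> /He; rewrite ltNge St2.
case: (ltP (sup S) b) => [clt|bc].
  2: by have -> : b = sup S by apply/le_anti; rewrite bc cb.
have [u /andP[cu ub] pu] := step _ ac clt.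
have : S u by split; [rewrite ub (le_trans ac (ltW cu)) | exact: le_trans pu].
by move=> /(ub_le_sup (ex_intro _ b Sub)); rewrite leNgt cu.
Qed.

(** With the three lemmas after it, this trades the liminf for real inequalities: lower bounds on
    [lip] need every small scale, upper bounds only arbitrarily small ones. *)
Lemma lip_ge f x c d : 0 < d ->
  (forall r, 0 < r < d -> exists2 y, `|x - y| <= r & c * r <= `|f x - f y|) ->
  (c%:E <= lip f x)%E.
Proof.
move=> d0 H; rewrite /lip limf_einfE; apply: le_ereal_sup_tmp.
exists (ereal_inf [set scaled_osc f x r | r in [set r | 0 < r < d]]).
  exists [set r | 0 < r < d] => //.
  near=> r => /=; apply/andP; split; near: r; first exact: nbhs_right_gt.
  exact: nbhs_right_lt.
apply: le_ereal_inf_tmp => _ [r /= /andP[r0 rd] <-].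
have [|y xy fxy] := H r; first by rewrite r0.
rewrite /scaled_osc -[c](mulKf (lt0r_neq0 r0)) EFinM lee_pmul2l ?lte_fin ?invr_gt0//.
apply: le_ereal_sup_tmp; exists (`|f x - f y|)%:E; first by exists y.
by rewrite lee_fin mulrC.
Unshelve. all: by end_near. Qed.

Lemma lip_le f x c :
  (forall d, 0 < d -> exists2 r, 0 < r < d &
     forall y, `|x - y| <= r -> `|f x - f y| <= c * r) ->
  (lip f x <= c%:E)%E.
Proof.
move=> H; rewrite /lip limf_einfE; apply: ge_ereal_sup => _ [V FV <-].
move: FV => /nbhs_ballP[e /= e0 He].
have [r /andP[r0 re] Hr] := H e e0.
apply: (@le_trans _ _ (scaled_osc f x r)).
  apply: ereal_inf_lbound; exists r => //; apply: He => //
; rewrite /ball/= sub0r normrN gtr0_norm//.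
rewrite /scaled_osc -[c](mulKf (lt0r_neq0 r0)) EFinM lee_pmul2l ?lte_fin ?invr_gt0//.
apply: ge_ereal_sup => _ [y xy <-].
by rewrite lee_fin mulrC Hr.
Qed.

Lemma lt_lip f x c : (c%:E < lip f x)%E ->
  exists2 d, 0 < d & forall r, 0 < r < d ->
    exists2 y, `|x - y| <= r & c * r < `|f x - f y|.
Proof.
rewrite ltNge => /negP; apply: contra_notP => H; apply: lip_le => d d0.
apply: contra_notP H => H; exists d => // r rd.
apply: contra_notP H => H; exists r => // y xy.
by rewrite leNgt; apply/negP => lt; apply: H; exists y.
Qed.

Lemma lip_lt f x c : (lip f x < c%:E)%E ->
  forall d, 0 < d -> exists2 r, 0 < r < d &
     forall y, `|x - y| <= r -> `|f x - f y| < c * r.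
Proof.
rewrite ltNge => /negP H d d0; apply: contra_notP H => H.
apply: (lip_ge d0) => r rd.
apply: contra_notP H => H; exists r => // y xy.
by rewrite ltNge; apply/negP => lt; apply: H; exists y.
Qed.

End basics.

(** * One-sided density *)

Section len.
Context {R : realType}.
Implicit Types (A B E : set R) (x y a b c d r : R).
Local Notation mu := (@lebesgue_measure R).

(** Real-valued for the sake of linear arithmetic; for measurable [A] nothing is lost under [fine],
    since [[a, b]] has finite measure. *)
Definition len A a b : R := fine (mu (A `&` `[a, b])).

Lemma measurable_setI_itv A a b : measurable A -> measurable (A `&` `[a, b]).
Proof. by move=> mA; apply: measurableI => //; exact: measurable_itv. Qed.

Lemma lebesgue_measure_cc a b : a <= b -> mu `[a, b] = (b - a)%:E.
Proof.
move=> ab; rewrite lebesgue_measure_itv/= lte_fin; case: ltgtP ab => // -> _.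
by rewrite subrr.
Qed.

Lemma lenE A a b : measurable A -> mu (A `&` `[a, b]) = (len A a b)%:E.
Proof.
move=> mA; rewrite fineK// ge0_fin_numE//.
have mAab := measurable_setI_itv a b mA.
apply: (@le_lt_trans _ _ (mu `[a, b])).
  by apply: le_measure; rewrite ?inE//; exact: measurable_itv.
have [ab|ba] := leP a b; first by rewrite lebesgue_measure_cc// ltry.
by rewrite set_itv_ge ?measure0 ?ltry// bnd_simp -ltNge.
Qed.

Lemma len_ge0 A a b : 0 <= len A a b.
Proof. exact: fine_ge0. Qed.

Lemma len_sub A B a b a' b' : measurable A -> measurable B ->
  (forall t, A t -> a <= t <= b -> B t /\ a' <= t <= b') ->
  len A a b <= len B a' b'.
Proof.
move=> mA mB AB; rewrite -lee_fin -!lenE//.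
apply: le_measure; rewrite ?inE; [exact: measurable_setI_itv..|].
by move=> t [/= At]; rewrite in_itv/= => /AB -/(_ At)[Bt tab]; split; rewrite //= in_itv.
Qed.

Lemma len_setT a b : a <= b -> len setT a b = b - a.
Proof. by move=> ab; rewrite /len setTI lebesgue_measure_cc. Qed.

Lemma len_le A a b : measurable A -> a <= b -> len A a b <= b - a.
Proof. by move=> mA ab; rewrite -len_setT//; apply: len_sub. Qed.

Lemma len_full A a b : measurable A -> a <= b -> (forall t, a <= t <= b -> A t) ->
  len A a b = b - a.
Proof.
move=> mA ab H; apply/le_anti; rewrite len_le//= -len_setT//.
by apply: len_sub => // t _ tab; split => //; exact: H.
Qed.

Lemma len_empty A a b : measurable A -> (forall t, a <= t <= b -> ~ A t) ->
  len A a b = 0.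
Proof.
move=> mA H; rewrite /len (_ : _ `&` _ = set0) ?measure0//.
by rewrite -subset0 => t [At]; rewrite /= in_itv/= => /H.
Qed.

Lemma len_split A a b c : measurable A -> a <= b -> b <= c ->
  len A a c = len A a b + len A b c.
Proof.
move=> mA ab bc; apply: EFin_inj; rewrite EFinD -!lenE//.
have mac := measurable_setI_itv a c mA.
have -> : A `&` `[a, c] = (A `&` `[a, b]) `|` (A `&` `]b, c]).
  rewrite -setIUr; congr (_ `&` _); apply/seteqP; split => t /=; rewrite !in_itv/=.
    by case: (leP t b) => tb /andP[-> ->]; [left|right].
  move=> [|] /andP[h1 h2]; first by rewrite h1 (le_trans h2).
  by rewrite h2 (le_trans ab (ltW h1)).
have mbc : measurable (A `&` `]b, c]) by apply: measurableI => //; exact: measurable_itv.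
rewrite measureU//; [|exact: measurable_setI_itv|]; last first.
  rewrite -subset0 => t [[_]] /[swap] [[_]]; rewrite /= !in_itv/= => /andP[bt _] /andP[_ tb].
  by rewrite leNgt bt in tb.
congr (_ + _)%E; apply/le_anti/andP; split.
  apply: le_measure; rewrite ?inE//; first exact: measurable_setI_itv.
  by apply: setIS => t; rewrite /= !in_itv/= => /andP[/ltW -> ->].
(* The added point [b] has measure zero. *)
apply: (@le_trans _ _ (mu ([set b] `|` (A `&` `]b, c])))).
  apply: le_measure; rewrite ?inE; [exact: measurable_setI_itv|exact: measurableU|].
  move=> t [/= At]; rewrite !in_itv/= le_eqVlt => /andP[/orP[/eqP->|bt] tc]; [by left|right].
  by split => //=; rewrite ?in_itv/= bt.
apply: (le_trans (measureU2 _ _ _)) => //.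
by rewrite [X in (X + _)%E](lebesgue_measure_set1 b) add0e.
Qed.

(** The maximum never exceeds 1, so convergence to 1 is only a lower bound. If no [d] works for [e],
    bad radii below [n.+1%:R^-1] form a sequence contradicting the definition. *)
Lemma SOSD_atP E x : measurable E ->
  strongly_one_sided_dense_at E x <->
  forall e, 0 < e -> exists2 d, 0 < d & forall r, 0 < r < d ->
    (1 - e) * r <= len E (x - r) x \/ (1 - e) * r <= len E x (x + r).
Proof.
move=> mE; pose M r := Num.max (r^-1 * len E (x - r) x) (r^-1 * len E x (x + r)).
have ME r : maxe (r^-1%:E * mu (E `&` `[(x - r)%R, x]))%E
    (r^-1%:E * mu (E `&` `[x, (x + r)%R]))%E = (M r)%:E by rewrite !lenE// -!EFinM -EFin_max.
have Mle1 r : 0 < r -> M r <= 1.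
  move=> r0; rewrite ge_max !ler_pdivrMl// mulr1.
  have := @len_le E (x - r) x mE; have := @len_le E x (x + r) mE.
  by move=> h1 h2; apply/andP; split; [have := h2 _|have := h1 _]; lra.
have Mge e r : 0 < r -> (1 - e <= M r) <->
    ((1 - e) * r <= len E (x - r) x \/ (1 - e) * r <= len E x (x + r)).
  move=> r0; rewrite le_max !ler_pdivlMl// ![r * _]mulrC.
  by split=> [/orP|[->//|->]]; rewrite ?orbT.
split=> [H e e0|H r r0 rcvg].
  apply: contrapT => nd.
  have /choice[r Hr] : forall n : nat, exists r, 0 < r < n.+1%:R^-1 /\ M r < 1 - e.
    move=> n; apply: contrapT => nr; apply: nd; exists n.+1%:R^-1; first by rewrite invr_gt0.
    move=> r rn; apply/Mge; first by case/andP: rn.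
    by rewrite leNgt; apply/negP => lt; apply: nr; exists r.
  have r0 n : 0 < r n by case: (Hr n) => /andP[].
  have rcvg : r n @[n --> \oo] --> 0.
    apply: (squeeze_cvgr _ (cvg_cst 0) (@cvg_harmonic R)).
    by apply: nearW => n; case: (Hr n) => /andP[/ltW -> /ltW ->].
  have := H r r0 rcvg.
  under eq_fun do rewrite ME.
  move=> /fine_cvgP[_] /cvgr_gt /(_ (1 - e)) []; first by lra.
  move=> N _ /(_ N (leqnn N)) /=; case: (Hr N) => _ lt; lra.
under eq_fun do rewrite ME.
apply: cvg_EFin; first exact: nearW.
apply/cvgrPdist_le => e e0.
have [d d0 Hd] := H e e0.
have : \forall n \near \oo, r n < d by exact: cvgr_lt rcvg _ d0.
apply: filterS => n rnd; rewrite /= ger0_norm ?subr_ge0 ?Mle1//.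
have : 1 - e <= M (r n) by apply/Mge => //; apply: Hd; rewrite r0.
lra.
Qed.

Lemma SOSD_at_sub A B x : measurable A -> measurable B -> A `<=` B ->
  strongly_one_sided_dense_at A x -> strongly_one_sided_dense_at B x.
Proof.
move=> mA mB AB /(SOSD_atP _ mA) H; apply/SOSD_atP => // e /H[d d0 Hd].
exists d => // r /Hd[|] h; [left|right]; apply: (le_trans h);
  by apply: len_sub => // t At tab; split => //; exact: AB.
Qed.

End len.

(** * 1-Lipschitz functions and the rising-sun estimate *)

Section lipschitz1.
Context {R : realType}.
Implicit Types (A B E K : set R) (x y a b c d r : R) (f : R -> R).
Local Notation mu := (@lebesgue_measure R).

Definition nonexpansive f := forall x y, `|f x - f y| <= `|x - y|.

Lemma nonexpansive_itv f x y : nonexpansive f -> x <= y ->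
  x - y <= f y - f x <= y - x.
Proof.
move=> /(_ y x) + xy; rewrite [`|y - x|]ger0_norm ?subr_ge0// ler_norml.
by rewrite opprB.
Qed.

Lemma nonexpansiveP f :
  (forall x y, x <= y -> `|f y - f x| <= y - x) -> nonexpansive f.
Proof.
move=> H x y; case: (leP x y) => [xy|/ltW yx].
  by rewrite distrC [leRHS]distrC [leRHS]ger0_norm ?subr_ge0// H.
by rewrite [leRHS]ger0_norm ?subr_ge0// H.
Qed.

Lemma nonexpansive_continuous f : nonexpansive f -> continuous f.
Proof.
move=> nf x; apply/cvgrPdist_lt => e e0.
near=> y; apply: (le_lt_trans (nf _ _)); near: y.
by exists e => //= y; rewrite /ball_/=.
Unshelve. all: by end_near. Qed.

Lemma nonexpansiveN f : nonexpansive f -> nonexpansive (\- f).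
Proof. by move=> nf x y; rewrite /= -opprD normrN; exact: nf. Qed.

Lemma closed_limP A :
  (forall x, (forall e, 0 < e -> exists2 y, A y & `|x - y| < e) -> A x) ->
  closed A.
Proof.
move=> H x clx; apply: H => e e0.
by have [y [Ay]] := clx _ (nbhsx_ballx x e e0); exists y.
Qed.

Lemma len_nonexpansive A a : measurable A -> nonexpansive (len A a).
Proof.
move=> mA; apply: nonexpansiveP => b c bc.
have [ab|ba] := leP a b.
  rewrite (len_split mA ab bc) addrAC subrr add0r ger0_norm ?len_ge0//.
  exact: len_le.
rewrite (@len_empty _ A a b)// => [|t]; last by lra.
rewrite subr0 ger0_norm ?len_ge0//.
have [ac|ca] := leP a c; first by have := len_le mA ac; lra.
by rewrite (@len_empty _ A a c)// => [|t]; lra.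
Qed.

(** For [c > 1] every point has a step to the right on which [f] varies by at most [c] times the
    length; [le_of_steps], applied to [c * t - f t] and [c * t + f t], chains them. *)
Lemma lip_le1_nonexpansive f : continuous f ->
  (forall x, (lip f x <= 1%:E)%E) -> nonexpansive f.
Proof.
move=> cf lf; apply: nonexpansiveP => a b ab.
rewrite -[b - a]mul1r; apply/ler_addgt0Pl => e e0.
have [->|ab'] := eqVneq a b.
  by rewrite !subrr normr0 mulr0 addr0 ltW.
have ba0 : 0 < b - a by rewrite subr_gt0 lt_neqAle ab'.
(* Chosen so that [c * (b - a)] exceeds [b - a] by exactly [e]. *)
pose c := 1 + e / (b - a).
have c1 : 1 < c by rewrite ltrDl divr_gt0.
have -> : e + 1 * (b - a) = c * (b - a).
  by rewrite /c mulrDl divfK ?gt_eqF// addrC.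
have step t : a <= t -> t < b -> exists2 u, t < u <= b & `|f t - f u| <= c * (u - t).
  move=> _ tb; have /lip_lt : (lip f t < c%:E)%E.
    by apply: (le_lt_trans (lf t)); rewrite lte_fin.
  have bt : 0 < b - t by lra.
  move=> /(_ _ bt)[r /andP[r0 rb] H].
  exists (t + r); first by apply/andP; split; lra.
  by rewrite [t + r - t]addrAC subrr add0r ltW// H// opprD addNKr normrN gtr0_norm.
have clin : continuous (fun t => c * t) by move=> t; apply: cvgM => //; exact: cvg_cst.
have h1 : c * a - f a <= c * b - f b.
  apply: (@le_of_steps _ (fun t => c * t - f t)) => //.
    by move=> t; apply: cvgB; [exact: clin|exact: cf].
  move=> t at_ tb; have [u tu] := step t at_ tb; rewrite ler_norml => /andP[u1 u2].
  by exists u => //; lra.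
have h2 : c * a + f a <= c * b + f b.
  apply: (@le_of_steps _ (fun t => c * t + f t)) => //.
    by move=> t; apply: cvgD; [exact: clin|exact: cf].
  move=> t at_ tb; have [u tu] := step t at_ tb; rewrite ler_norml => /andP[u1 u2].
  by exists u => //; lra.
by rewrite ler_norml; apply/andP; split; lra.
Qed.

(** Outer regularity. An open [V] contains a neighbourhood of each point of [K], which the stepping
    argument below needs. *)
Lemma len_outer K p q m : closed K -> (forall t, K t -> p <= t <= q) ->
  (forall V, open V -> K `<=` V -> m <= len V p q) -> m <= len K p q.
Proof.
move=> cK Kpq H; have mK := closed_measurable cK.
apply/ler_addgt0Pr => e e0.
have Kfin : (mu K < +oo)%E.
  have -> : K = K `&` `[p, q].
    by apply/seteqP; split=> [t Kt|t []//]; split => //=; rewrite in_itv/= Kpq.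
  by rewrite lenE// ltry.
have [V [oV KV VK]] := lebesgue_regularity_outer mK Kfin e0.
have mV := open_measurable oV.
apply: (le_trans (H V oV KV)).
rewrite -lee_fin EFinD -!lenE//.
apply: (@le_trans _ _ (mu ((K `&` `[p, q]) `|` (V `\` K)))).
  have ? : measurable (V `\` K) by exact: measurableD.
  apply: le_measure; rewrite ?inE.
  - exact: measurable_setI_itv.
  - by apply: measurableU => //; exact: measurable_setI_itv.
  - move=> t [Vt tpq]; have [Kt|nKt] := pselect (K t); first by left.
    by right.
apply: (le_trans (measureU2 _ _ _)).
- exact: measurable_setI_itv.
- exact: measurableD.
- by apply: leeD => //; exact: ltW.
Qed.

(* A rising-sun argument: the excluded [t] lie left of some [u] on which
   [t - f t] gains at least half of the length, and this gain is at most
   [e * (q - p)] in total. *)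
Lemma good_points_rising f p q e : nonexpansive f -> p < q ->
  (1 - e) * (q - p) <= f q - f p ->
  exists2 K, closed K & (1 - 2 * e) * (q - p) <= len K p q /\
    forall t, K t -> p <= t <= q /\
      forall u, t <= u <= q -> (u - t) / 2 <= f u - f t.
Proof.
move=> nf pq fpq.
pose K := [set t | p <= t <= q /\ forall u, t <= u <= q -> (u - t) / 2 <= f u - f t].
have cK : closed K.
  apply: closed_limP => x H.
  have xpq : p <= x <= q.
    apply/andP; split; rewrite leNgt; apply/negP => lt.
      have [|y [/andP[y1 y2] _]] := H (p - x); first by rewrite subr_gt0.
      by rewrite ltr_norml => /andP[]; lra.
    have [|y [/andP[y1 y2] _]] := H (x - q); first by rewrite subr_gt0.
    by rewrite ltr_norml => /andP[]; lra.
  split=> // u /andP[xu uq]; rewrite leNgt; apply/negP => lt.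
  have xu' : 0 < u - x.
    by rewrite subr_gt0 lt_neqAle xu andbT; apply/eqP => ux; rewrite ux !subrr mul0r ltxx in lt.
  pose m := Num.min (u - x) (((u - x) / 2 - (f u - f x)) / 2).
  have m0 : 0 < m by rewrite lt_min xu'/=; lra.
  have m1 : m <= u - x by rewrite ge_min lexx.
  have m2 : m <= ((u - x) / 2 - (f u - f x)) / 2 by rewrite ge_min lexx orbT.
  have [y [ypq Hy]] := H _ m0.
  move=> xym; have := le_lt_trans (nf x y) xym; move: xym.
  rewrite !ltr_norml => /andP[xy1 xy2] /andP[fxy1 fxy2].
  have yu : y <= u <= q by rewrite uq andbT; lra.
  by have := Hy u yu; lra.
exists K => //; split; last by move=> t [].
apply: len_outer => //; first by move=> t [].
move=> V oV KV; have mV := open_measurable oV.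
(* [phi] can always step right without decreasing: at [t] in [K] the measure of [V] adds slope 1/2,
   making up for the worst case [1 / 2 - 1]; at other [t] some [u] has [f] gaining less than half
   the length. Comparing the ends gives [2 * (f q - f p) - (q - p) <= len V p q]. *)
pose phi t := t / 2 - f t + len V p t / 2.
have : phi p <= phi q.
  apply: (le_of_steps (ltW pq)).
    have cl := nonexpansive_continuous (len_nonexpansive p mV).
    have cf := nonexpansive_continuous nf.
    move=> t; apply: cvgD; first apply: cvgB.
    - by apply: cvgM => //; exact: cvg_cst.
    - exact: cf.
    - by apply: cvgM; [exact: cl|exact: cvg_cst].
  move=> t pt tq.
  have [Kt|nKt] := pselect (K t).
    have := oV _ (KV _ Kt) => /nbhs_ballP[d /= d0 dV].
    pose u := Num.min (t + d / 2) q.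
    have u1 : u <= q by rewrite ge_min lexx orbT.
    have u2 : u <= t + d / 2 by rewrite ge_min lexx.
    have tu : t < u by rewrite lt_min tq andbT; lra.
    exists u; first by rewrite tu.
    rewrite /phi (len_split mV pt (ltW tu)) (len_full mV (ltW tu)).
      have /andP[] := nonexpansive_itv nf (ltW tu); lra.
    by move=> s /andP[s1 s2]; apply: dV; rewrite /ball/= ltr_norml; lra.
  have [u tuq lt] : exists2 u, t <= u <= q & f u - f t < (u - t) / 2.
    apply: contrapT => nu; apply: nKt; split; first by rewrite pt ltW.
    by move=> u tuq; rewrite leNgt; apply/negP => lt; apply: nu; exists u.
  have tu : t < u.
    move/andP: tuq => [tu _]; rewrite lt_neqAle tu andbT; apply/eqP => ut.
    by rewrite ut !subrr mul0r ltxx in lt.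
  exists u; first by case/andP: tuq => _ ->; rewrite tu.
  rewrite /phi (len_split mV pt (ltW tu)).
  by have := len_ge0 V t u; lra.
rewrite /phi [len V p p](_ : _ = 0); last first.
  by apply/le_anti; rewrite len_ge0 andbT -[leRHS](subrr p); exact: len_le.
lra.
Qed.

End lipschitz1.

(** * Points of uniform oscillation *)

Section good.
Context {R : realType}.
Implicit Types (A B E K : set R) (x y a b c d e r s t : R) (f : R -> R).
Local Notation mu := (@lebesgue_measure R).

Definition osc_at f c s t := exists2 y, `|t - y| <= s & c * s <= `|f t - f y|.

(** Up to a sign [good_points_rising] applies. Its points look right while [t + s <= q]; otherwise
    they look left, which works once a final piece of length [4 * e * (q - p)] is dropped. *)
Lemma good_points f p q e : nonexpansive f -> p < q -> 0 <= e -> e <= 1 / 8 ->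
  (1 - e) * (q - p) <= `|f q - f p| ->
  exists2 K, closed K & (1 - 6 * e) * (q - p) <= len K p q /\
    forall t, K t -> p <= t <= q /\
      forall s, 0 < s <= (q - p) / 2 -> osc_at f (1 / 2) s t.
Proof.
move=> + pq e0 e8; wlog fpq : f / 0 <= f q - f p.
  move=> H nf He; have [fpq|/ltW fpq] := leP 0 (f q - f p); first exact: H.
  have [| | |K cK [lK HK]] := H (\- f).
  - by rewrite /=; lra.
  - exact: nonexpansiveN.
  - by rewrite /= -opprD normrN.
  exists K => //; split => // t /HK[tpq Ht]; split => // s /Ht[y ty].
  by rewrite /= -opprD normrN; exists y.
move=> nf; rewrite ger0_norm// => fpq'.
have [K cK [lK HK]] := good_points_rising nf pq fpq'.
have L0 : 0 < q - p by lra.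
have eL0 : 0 <= e * (q - p) by rewrite mulr_ge0// ltW.
have eL8 : e * (q - p) <= (1 / 8) * (q - p) by rewrite ler_pM2r.
pose w := q - 4 * e * (q - p).
have wE : w = q - 4 * e * (q - p) by [].
exists (K `&` [set t | t <= w]).
  by apply: closedI => //; exact: closed_le.
have mK := closed_measurable cK.
have mKw : measurable (K `&` [set t | t <= w]).
  by apply: closed_measurable; apply: closedI => //; exact: closed_le.
split.
  have pw : p <= w by lra.
  have wq : w <= q by lra.
  rewrite (len_split mK pw wq) in lK.
  have := len_le mK wq.
  have : len K p w <= len (K `&` [set t | t <= w]) p q.
    apply: len_sub => // t Kt /andP[pt tw]; split => //.
    by rewrite pt (le_trans tw).
  by lra.
move=> t [Kt /= tw]; have [tpq Ht] := HK _ Kt; split => // s /andP[s0 sL].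
have /andP[pt tq] := tpq.
have [tsq|qts] := leP (t + s) q.
  exists (t + s); first by rewrite opprD addNKr normrN gtr0_norm.
  have := Ht (t + s); rewrite tsq andbT => /(_ ltac:(lra)) h.
  by rewrite distrC (le_trans _ (ler_norm _))//; lra.
(* Over [[p, t - s]] and [[t, q]] the gains are at most the lengths, so [f] gains at least
   [s - e * (q - p)] on [[t - s, t]]; this suffices because [s > q - t >= 4 * e * (q - p)]. *)
exists (t - s); first by rewrite subKr gtr0_norm.
rewrite (le_trans _ (ler_norm _))//.
have /andP[_ h1] := nonexpansive_itv nf tq.
have pts : p <= t - s by lra.
have /andP[_ h2] := nonexpansive_itv nf pts.
lra.
Qed.

(* Quantifying over [c' < c] makes this set closed without a compactness
   argument. *)
Definition osc_set f c h := [set t | forall s c', 0 < s <= h -> c' < c -> osc_at f c' s t].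

Lemma osc_set_closed f c h : nonexpansive f -> c <= 1 -> closed (osc_set f c h).
Proof.
move=> nf c1; apply: closed_limP => x H s c' /andP[s0 sh] cc'.
have [c'0|c'0] := leP c' 0.
  exists x; rewrite !subrr normr0; first exact: ltW.
  by rewrite mulr_le0_ge0// ltW.
(* A witness for a nearby [t] at scale [s - e] with constant [c2] serves [x] at scale [s]: the
   margin [2 * e] of [c2 * s] over [c' * s] pays for the smaller scale and for the move from [t] to
   [x]. *)
pose c2 := (c' + c) / 2; pose e := (c2 - c') * s / 2.
have cc : c' < c2 < c by rewrite /c2; lra.
have e0 : 0 < e by rewrite /e divr_gt0// mulr_gt0//; lra.
have es : e < s / 2.
  by rewrite /e ltr_pM2r// gtr_pMl//; lra.
have [t /(_ (s - e) c2) Ht xt] := H e e0.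
have [|| y ty fy] := Ht; [lra|lra|].
exists y.
  have := ler_distD t x y; lra.
have := ler_distD x (f x) (f y) ; have := nf x t.
have := ler_distD (f x) (f t) (f y); rewrite (distrC (f t) (f x)).
have : c' * s + e <= c2 * (s - e).
  have : c2 * e <= e by rewrite ger_pMl//; lra.
  have : c2 * s - c' * s = 2 * e by rewrite /e; lra.
  by lra.
by lra.
Qed.

(** The witness [y] of [x] at scale [r] is at distance at least [(1 - e) * r], and [good_points]
    covers most of the interval between them; 7 comes from [(1 - 6 * e) * (1 - e) >= 1 - 7 * e]. *)
Lemma one_sided_osc_set f x e d : nonexpansive f -> 0 < e -> e <= 1 / 8 -> 0 < d ->
  (forall r, 0 < r < d -> osc_at f (1 - e) r x) ->
  forall r, 0 < r < d / 2 ->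
    (1 - 7 * e) * r <= len (osc_set f (1 / 16) (d / 2)) (x - r) x \/
    (1 - 7 * e) * r <= len (osc_set f (1 / 16) (d / 2)) x (x + r).
Proof.
move=> nf e0 e8 d0 H r /andP[r0 rd].
have mD : measurable (osc_set f (1 / 16) (d / 2)).
  by apply: closed_measurable; apply: osc_set_closed => //; lra.
have [|y xy fxy] := H r; first by rewrite r0/=; lra.
have fxy' := le_trans fxy (nf x y).
have er8 : e * r <= (1 / 8) * r by rewrite ler_pM2r.
have er0 : 0 < e * r by rewrite mulr_gt0.
have main p q : (p <= x <= q) -> q - p = `|x - y| ->
    `|f q - f p| = `|f x - f y| ->
    (1 - 7 * e) * r <= len (osc_set f (1 / 16) (d / 2)) p q.
  move=> pxq qp fqp.
  have pq : p < q by lra.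
  have [|K cK [lK HK]] := @good_points f p q e nf pq (ltW e0) e8.
    rewrite fqp qp (le_trans _ fxy)// ler_pM2l//; lra.
  have mK := closed_measurable cK.
  have : len K p q <= len (osc_set f (1 / 16) (d / 2)) p q.
    apply: len_sub => // t Kt tpq; split => // s c' /andP[s0 sd] c'16.
    suff [z tz fz] : osc_at f (1 / 16) s t.
      by exists z => //; apply: (le_trans _ fz); rewrite ler_pM2r// ltW.
    have [_ Ht] := HK _ Kt.
    (* Up to half the interval [good_points] applies; up to [2 * r] its witness at that half length
       still suffices; beyond, [t] is within [s / 2] of [x], and either [x] or the witness of [x] at
       scale [s / 2] serves. *)
    have [sL|Ls] := leP s ((q - p) / 2).
      by have [|z tz fz] := Ht s; [rewrite s0|exists z => //; lra].
    have [s2r|rs] := leP s (2 * r).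
      have [|z tz fz] := Ht ((q - p) / 2); first by rewrite lexx andbT; lra.
      by exists z; lra.
    have [|z xz fz] := H (s / 2); first by lra.
    have tx : `|t - x| <= s / 2 by rewrite ler_norml; lra.
    have es8 : e * s <= (1 / 8) * s by rewrite ler_pM2r.
    have [h|h] := leP (1 / 16 * s) `|f t - f x|; first by exists x => //; lra.
    exists z; first by have := ler_distD x t z; lra.
    by have := ler_distD (f t) (f x) (f z); rewrite (distrC (f x) (f t)); lra.
  have : (1 - 7 * e) * r <= (1 - 6 * e) * ((1 - e) * r).
    have : 0 <= e * (e * r) by rewrite mulr_ge0// ltW.
    by lra.
  have : (1 - 6 * e) * ((1 - e) * r) <= (1 - 6 * e) * (q - p).
    by rewrite ler_pM2l; lra.
  by lra.
have [yx|/ltW xley] := leP y x.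
  left; have yx' : `|x - y| = x - y by rewrite ger0_norm// subr_ge0.
  apply: (le_trans (main y x _ _ _)) => //; first by rewrite lexx yx.
  by apply: len_sub => // t Dt txy; rewrite yx' in xy; split => //; lra.
right; have yx' : `|x - y| = y - x by rewrite distrC ger0_norm// subr_ge0.
apply: (le_trans (main x y _ _ _)) => //; first by rewrite lexx xley.
  by rewrite distrC.
by apply: len_sub => // t Dt txy; rewrite yx' in xy; split => //; lra.
Qed.

(** Density above [1 - e / 2] on a ball of length [2 * r] loses at most [e * r], even if all the
    loss falls on one side. *)
Lemma density_sides A x : measurable A -> A x ->
  (mu (A `&` ball x r) * (mu (ball x r))^-1)%E @[r --> 0^'+] --> (\1_A x)%:E ->
  forall e, 0 < e -> exists2 d, 0 < d & forall r, 0 < r < d ->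
    (1 - e) * r <= len A (x - r) x /\ (1 - e) * r <= len A x (x + r).
Proof.
move=> mA Ax; rewrite indicE mem_set// => H e e0.
have : ((1 - e / 2)%:E < 1%:E :> \bar R)%E by rewrite lte_fin; lra.
move=> /open_ereal_gt' /H /nbhs_ballP[d /= d0 Hd]; exists d => // r /andP[r0 rd].
have /Hd : ball 0 d r by rewrite /ball/= sub0r normrN gtr0_norm.
move=> /(_ r0); rewrite (lebesgue_measure_ball x (ltW r0)) => lt.
have lA : (mu (A `&` ball x r) <= (len A (x - r) (x + r))%:E)%E.
  rewrite -lenE//; apply: le_measure; rewrite ?inE.
  - by apply: measurableI => //; exact: measurable_ball.
  - exact: measurable_setI_itv.
  - by apply: setIS => t; rewrite /ball/= in_itv/= ltr_distlC => /andP[/ltW-> /ltW->].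
have r2 : 0 < r *+ 2 by rewrite mulrn_wgt0.
have : ((1 - e / 2)%:E < (len A (x - r) (x + r) / (r *+ 2))%:E)%E.
  apply: (lt_le_trans lt); rewrite inver gt_eqF// EFinM lee_pmul2r// lte_fin invr_gt0//.
have xr : x <= x + r by lra.
have rx : x - r <= x by lra.
rewrite lte_fin ltr_pdivlMr// (len_split mA rx xr) => h.
by have := len_le mA xr; have := len_le mA rx; split; lra.
Qed.

End good.

(** * Generic dyadic grids *)

Section translation.
Context {R : realType}.
Local Notation mu := (@lebesgue_measure R).

Lemma measurable_translation (d : R) :
  measurable_fun setT (+%R^~ d : measurableTypeR R -> measurableTypeR R).
Proof.
apply: (@measurable_funD _ _ _ setT id (cst d)) => //.
Qed.

Lemma lebesgue_measure_translation (d : R) (A : set R) : measurable A ->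
  pushforward mu (+%R^~ d : _ -> measurableTypeR R) A = mu A.
Proof.
move=> mA; apply/esym/lebesgue_measure_unique => //=; first exact: measurable_translation.
move=> ? _ [[a b]] _ <-.
rewrite /pushforward/= (_ : _ @^-1` _ = `](a - d)%R, (b - d)%R]%classic); last first.
  by apply/seteqP; split => x /=; rewrite !in_itv/= ltrBlDr lerBrDr.
by rewrite !lebesgue_measure_itv/= !lte_fin ltrD2r -!EFinD opprD opprK addrACA addNr addr0.
Qed.

Lemma negligible_translation (d : R) (N : set R) :
  mu.-negligible N -> mu.-negligible [set x | N (x + d)].
Proof.
move=> [A [mA A0 NA]]; exists ((+%R^~ d) @^-1` A); split.
- by rewrite -[X in measurable X]setTI; exact: measurable_translation.
- exact: (eq_trans (lebesgue_measure_translation d mA)).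
- by move=> x; exact: NA.
Qed.

Lemma negligible_neqT (N : set R) : mu.-negligible N -> exists x, ~ N x.
Proof.
move=> [A [mA A0 NA]]; apply: contrapT => nx.
have AT : A = setT.
  by apply/seteqP; split => // x _; apply: NA; apply: contrapT => Nx; apply: nx; exists x.
have : (mu `[0%R, 1%R] <= mu A)%E.
  by apply: le_measure; rewrite ?inE// ?AT//; exact: measurable_itv.
by rewrite A0 lebesgue_measure_cc// subr0 lee_fin ler10.
Qed.

(** The bad [theta] form a countable union of translates of null sets. *)
Lemma generic_grid (P : nat -> set R) : (forall m, mu.-negligible (~` P m)) ->
  exists theta, forall m (i : int) (k : nat), P m (theta + i%:~R / 2 ^+ k).
Proof.
move=> HP.
pose F n := if (unpickle n : option (nat * int * nat)) is Some (m, i, k)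
  then [set x | (~` P m) (x + i%:~R / 2 ^+ k)] else set0.
have /negligible_bigcup/negligible_neqT[theta Ht] : forall n, mu.-negligible (F n).
  move=> n; rewrite /F; case: unpickle => [[[m i] k]|]; last exact: negligible_set0.
  exact: negligible_translation.
exists theta => m i k; apply: contrapT => nP; apply: Ht.
by exists (pickle (m, i, k)) => //; rewrite /F pickleK.
Qed.

End translation.

(** * Cells of a translated dyadic grid *)

Section grid.
Context {R : realType}.
Variables (f : R -> R) (theta : R).
Implicit Types (x y t u : R) (k m n : nat).

(** The half-open cells are described through thresholds, which avoids indices and makes the
    equivalence laws immediate. *)
Definition same_cell k x y :=
  forall i : int, (theta + i%:~R / 2 ^+ k <= x) = (theta + i%:~R / 2 ^+ k <= y).

Lemma same_cell_sym k x y : same_cell k x y -> same_cell k y x.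
Proof. by move=> H i; rewrite H. Qed.

Lemma same_cell_trans k x y z : same_cell k x y -> same_cell k y z -> same_cell k x z.
Proof. by move=> H1 H2 i; rewrite H1. Qed.

Lemma same_cell_le k m x y : (k <= m)%N -> same_cell m x y -> same_cell k x y.
Proof.
move=> /subnK; move: (m - k)%N => d <- H i; have := H (i * 2 ^+ d)%R.
suff -> : (i * 2 ^+ d)%:~R / 2 ^+ (d + k) = i%:~R / 2 ^+ k :> R by [].
rewrite intrM rmorphXn/= exprD invfM mulrA; congr (_ / _).
by rewrite [LHS](mulfK (_ : 2 ^+ d != 0 :> R)) ?expf_neq0.
Qed.

Lemma grid_floor k x : exists i : int,
  theta + i%:~R / 2 ^+ k <= x < theta + i%:~R / 2 ^+ k + (2 ^+ k)^-1.
Proof.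
exists (Num.floor ((x - theta) * 2 ^+ k)).
have p0 : (0 : R) < 2 ^+ k by rewrite exprn_gt0.
have /andP[h1 h2] := floor_itv ((x - theta) * 2 ^+ k).
rewrite -lerBrDl ler_pdivrMr// h1/= -addrA -ltrBlDl -[X in _ / _ + X]mul1r -mulrDl.
by rewrite ltr_pdivlMr// (lt_le_trans h2)// intrD.
Qed.

Lemma same_cell_dist k x y : same_cell k x y -> `|x - y| < (2 ^+ k)^-1.
Proof.
move=> H; have [i /andP[i1 i2]] := grid_floor k x.
have := H i; rewrite i1 => /esym j1.
have := H (i + 1); rewrite intrD mulrDl mul1r addrA [LHS]leNgt i2/= => /esym/negbT.
by rewrite -ltNge => j2; rewrite ltr_norml; lra.
Qed.

Lemma same_cellP k (i : int) x :
  theta + i%:~R / 2 ^+ k <= x < theta + i%:~R / 2 ^+ k + (2 ^+ k)^-1 ->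
  same_cell k (theta + i%:~R / 2 ^+ k) x.
Proof.
move=> /andP[h1 h2] j; have p0 : (0 : R) < (2 ^+ k)^-1 by rewrite invr_gt0 exprn_gt0.
have [ji|ij] := leP j i.
  have le : theta + j%:~R / 2 ^+ k <= theta + i%:~R / 2 ^+ k.
    by rewrite lerD2l ler_pM2r// ler_int.
  by rewrite le (le_trans le h1).
have le : theta + i%:~R / 2 ^+ k + (2 ^+ k)^-1 <= theta + j%:~R / 2 ^+ k.
  by rewrite -addrA lerD2l -[X in _ + X <= _]mul1r -mulrDl ler_pM2r// -intrD1 ler_int lezD1.
by apply/esym; rewrite !leNgt (lt_le_trans h2 le) (lt_le_trans _ le)// ltrDl.
Qed.

(** Any point of the cell may oscillate on behalf of [t], so goodness is a property of cells. The
    constant 1/32 lies strictly below the 1/16 of [osc_set], which grants only smaller constants. *)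
Definition cell_good k t :=
  exists2 t', same_cell k t t' & osc_at f (1 / 32) ((2 ^+ k)^-1) t'.

Definition good_upto n m := [set t | forall k, (n <= k <= m)%N -> cell_good k t].

Definition good_from n := \bigcap_(m in [set m | (n <= m)%N]) closure (good_upto n m).

Lemma good_upto_cell n m t t' : same_cell m t t' -> good_upto n m t -> good_upto n m t'.
Proof.
move=> tt' H k /andP[nk km]; have [|z tz z1] := H k; first by rewrite nk.
exists z => //; apply: same_cell_trans tz.
by apply/same_cell_sym/(same_cell_le km).
Qed.

Lemma good_from_closed n : closed (good_from n).
Proof. by apply: closed_bigI => m _; exact: closed_closure. Qed.

(** From level [m] on, [t] is its own witness. *)
Lemma good_upto_osc_set n m h t : (2 ^+ m)^-1 <= h ->
  osc_set f (1 / 16) h t -> good_upto n m t -> good_from n t.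
Proof.
move=> mh Dt Gt m' _; apply: subset_closure => k /andP[nk km'].
have [km|/ltnW mk] := leqP k m; first by apply: Gt; rewrite nk.
exists t => //; apply: Dt; last by lra.
rewrite invr_gt0 exprn_gt0//= (le_trans _ mh)// lef_pV2 ?posrE ?exprn_gt0//.
by rewrite ler_weXn2l// ler1n.
Qed.

(** Off the grid, [x] is interior to its cell of level [m]; a point of [good_upto n m] close to [x]
    lies in that cell and makes all of it good. *)
Lemma good_from_side n m x : (n <= m)%N -> good_from n x ->
  (forall i : int, x <> theta + i%:~R / 2 ^+ m) ->
  exists2 d, 0 < d & forall t, `|x - t| < d -> good_upto n m t.
Proof.
move=> nm xF xg; have [i /andP[i1 i2]] := grid_floor m x.
have i1' : theta + i%:~R / 2 ^+ m < x.
  by rewrite lt_neqAle i1 andbT; apply/eqP => /esym; exact: xg.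
set p := theta + _ in i1 i1' i2.
pose d := Num.min (x - p) (p + (2 ^+ m)^-1 - x).
have d0 : 0 < d by rewrite lt_min; apply/andP; split; lra.
have H t : `|x - t| < d -> same_cell m p t.
  rewrite lt_min !ltr_norml => /andP[t1 t2]; apply: same_cellP; rewrite -/p; lra.
have [t [Gt xt]] := xF m nm _ (nbhsx_ballx x d d0).
exists d => // u xu; apply: good_upto_cell Gt.
by apply: same_cell_trans (H _ xu); apply/same_cell_sym/H.
Qed.

(** A grid point touches two cells; an approximating point of [good_upto n m] lies in one of them,
    and nothing tells which. *)
Lemma good_from_grid_side n m x (i : int) : (n <= m)%N -> good_from n x ->
  x = theta + i%:~R / 2 ^+ m ->
  exists2 d, 0 < d & (forall t, x - d < t < x -> good_upto n m t) \/
    (forall t, x <= t < x + d -> good_upto n m t).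
Proof.
move=> nm xF xi; pose d : R := (2 ^+ m)^-1.
have d0 : 0 < d by rewrite invr_gt0 exprn_gt0.
have [t [Gt]] := xF m nm _ (nbhsx_ballx x d d0).
rewrite /ball/= ltr_norml => /andP[xt1 xt2].
exists d => //; have [xt|tx] := leP x t.
  right => u xu; apply: good_upto_cell Gt.
  have ci v : x <= v < x + d -> same_cell m x v by rewrite xi; exact: same_cellP.
  apply: same_cell_trans (ci _ xu); apply/same_cell_sym/ci.
  by rewrite xt; lra.
left => u xu; apply: good_upto_cell Gt.
pose p := theta + (i - 1)%:~R / 2 ^+ m.
have px : p + d = x by rewrite xi /p /d intrD mulrDl mulNr mul1r addrA subrK.
have ci v : x - d < v < x -> same_cell m p v.
  by move=> v1; apply: same_cellP; rewrite -/p -/d; lra.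
by apply: same_cell_trans (ci _ xu); apply/same_cell_sym/ci; lra.
Qed.

End grid.

(** * From functions to closed sets *)

Section necessity.
Context {R : realType}.
Implicit Types (E : set R) (f : R -> R) (x d r e : R).

Lemma exists_pow2_lt n d : 0 < d -> exists2 m, (n <= m)%N & (2 ^+ m)^-1 < d.
Proof.
move=> d0.
have [m Hm] : exists m, (2 ^+ m)^-1 < d.
  have : \forall m \near \oo, (2^-1 : R) ^+ m < d.
    by apply: (cvgr_lt _ (cvg_expr _)); rewrite ?ger0_norm; lra.
  by move=> [m _ /(_ m (leqnn m))]; rewrite /= exprVn; exists m.
exists (maxn n m); first exact: leq_maxl.
apply: (le_lt_trans _ Hm); rewrite lef_pV2 ?posrE ?exprn_gt0//.
by rewrite ler_weXn2l ?ler1n ?leq_maxr.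
Qed.

Lemma dyadic_scale n r : 0 < r -> r <= (2 ^+ n)^-1 ->
  exists2 k, (n <= k)%N & (2 ^+ k.+1)^-1 < r <= (2 ^+ k)^-1.
Proof.
move=> r0 rn; have [m nm Hm] := exists_pow2_lt n r0.
elim: m nm Hm => [|m IH].
  by rewrite leqn0 => /eqP n0 lt; rewrite n0 leNgt lt in rn.
move=> nm Hm; have [rm|mr] := leP r (2 ^+ m)^-1.
  have [nm'|mn] := leqP n m; first by exists m => //; rewrite Hm.
  have nm2 : n = m.+1 by apply/eqP; rewrite eqn_leq nm.
  by rewrite nm2 leNgt Hm in rn.
have [nm'|mn] := leqP n m; first exact: IH.
have nm2 : n = m.+1 by apply/eqP; rewrite eqn_leq nm.
by rewrite nm2 leNgt Hm in rn.
Qed.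

(** Three hops of length at most [2^-(k+1) < r / 8] lead from [x] to [y]. The oscillation from [t']
    to [y] is at least [2^-(k+1) / 32 >= r / 512], and half of it is seen from [x] at [t'] or at
    [y]. *)
Lemma good_from_osc f theta n x : good_from f theta n x ->
  forall r, 0 < r < (2 ^+ n)^-1 -> osc_at f (1 / 1024) r x.
Proof.
move=> xF r /andP[r0 rn].
have [||k nk /andP[k1 k2]] := @dyadic_scale n (r / 8); [lra|lra|].
have s0 : 0 < (2 ^+ k.+1)^-1 :> R by rewrite invr_gt0 exprn_gt0.
have ss : (2 ^+ k)^-1 = 2 * (2 ^+ k.+1)^-1 :> R by rewrite exprS invfM mulrA divff// mul1r.
have nk1 : (n <= k.+1)%N by rewrite (leq_trans nk).
have [t [Gt]] := xF _ nk1 _ (nbhsx_ballx x _ s0).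
rewrite /ball/= => xt.
have [|t' tt' [y ty fy]] := Gt k.+1; first by rewrite leqnn nk1.
move/same_cell_dist in tt'.
have xt' : `|x - t'| <= r by have := ler_distD t x t'; lra.
have xy : `|x - y| <= r by have := ler_distD t' x y; have := ler_distD t x t'; lra.
have [h|h] := leP (1 / 1024 * r) `|f x - f t'|; first by exists t'.
exists y => //.
by have := ler_distD (f x) (f t') (f y); rewrite (distrC (f t') (f x)); lra.
Qed.

(** Off the grid both sides of [x] share its coarse levels, so it does not matter which side
    [one_sided_osc_set] supplies. At a grid point only one side is sure to share them, possibly the
    wrong one; hence the two-sided density assumed at grid points. *)
Lemma good_from_SOSD f theta n x : nonexpansive f ->
  (forall m (i : int) (k : nat), let p := theta + i%:~R / 2 ^+ k in
    osc_set f (1 / 16) (2 ^+ m)^-1 p ->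
    forall e, 0 < e -> exists2 d, 0 < d & forall r, 0 < r < d ->
      (1 - e) * r <= len (osc_set f (1 / 16) (2 ^+ m)^-1) (p - r) p /\
      (1 - e) * r <= len (osc_set f (1 / 16) (2 ^+ m)^-1) p (p + r)) ->
  (forall e, 0 < e -> exists2 d, 0 < d &
     forall r, 0 < r < d -> osc_at f (1 - e) r x) ->
  good_from f theta n x -> strongly_one_sided_dense_at (good_from f theta n) x.
Proof.
move=> nf dens xE xF.
have mosc h : measurable (osc_set f (1 / 16) h).
  by apply: closed_measurable; apply: osc_set_closed => //; lra.
have mF : measurable (good_from f theta n).
  by apply: closed_measurable; exact: good_from_closed.
apply/SOSD_atP => // e e0.
(* [one_sided_osc_set] loses [7 * e1] and asks for [e1 <= 1 / 8]. *)
pose e1 := Num.min (e / 7) (1 / 8).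
have e10 : 0 < e1 by rewrite lt_min; lra.
have e1e : e1 <= e / 7 by rewrite ge_min lexx.
have e18 : e1 <= 1 / 8 by rewrite ge_min lexx orbT.
have [d1 d10 Hd1] := xE e1 e10.
have [|m nm Hm] := @exists_pow2_lt n (d1 / 2); first by lra.
have [[i xi]|nxi] := pselect (exists i : int, x = theta + i%:~R / 2 ^+ m).
  have [d2 d20 side] := good_from_grid_side nm xF xi.
  have := dens m i m; rewrite /= -xi => H.
  have [|d3 d30 Hd3] := H _ e e0.
    move=> s c' /andP[s0 sd] c'16.
    have [|y xy fy] := Hd1 s; first by lra.
    exists y => //; apply: (le_trans _ fy); rewrite ler_pM2r//; lra.
  exists (Num.min d2 d3); first by rewrite lt_min d20.
  move=> r /andP[r0]; rewrite lt_min => /andP[rd2 rd3].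
  have [|lr rr] := Hd3 r; first by rewrite r0.
  case: side => side; [left; apply: (le_trans lr)|right; apply: (le_trans rr)];
    apply: len_sub => // t Dt txr; split => //.
    have [tx|xt] := ltP t x; last by have -> : t = x by lra.
    by apply: (good_upto_osc_set (lexx _) Dt); apply: side; lra.
  by apply: (good_upto_osc_set (lexx _) Dt); apply: side; lra.
have [|d2 d20 side] := good_from_side nm xF.
  by move=> i xi; apply: nxi; exists i.
exists (Num.min (d1 / 2) d2); first by rewrite lt_min; lra.
move=> r /andP[r0]; rewrite lt_min => /andP[rd1 rd2].
have [|H|H] := one_sided_osc_set nf e10 e18 d10 Hd1 (r := r); first by rewrite r0.
  left; apply: (@le_trans _ _ ((1 - 7 * e1) * r)); first by rewrite ler_pM2r//; lra.
  apply: (le_trans H); apply: len_sub => // t Dt txr; split => //.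
  by apply: (good_upto_osc_set (ltW Hm) Dt); apply: side; rewrite ltr_norml; lra.
right; apply: (@le_trans _ _ ((1 - 7 * e1) * r)); first by rewrite ler_pM2r//; lra.
apply: (le_trans H); apply: len_sub => // t Dt txr; split => //.
by apply: (good_upto_osc_set (ltW Hm) Dt); apply: side; rewrite ltr_norml; lra.
Qed.

Lemma lip1_bigcup_SOSD E : lip1 E ->
  exists En : nat -> set R,
    E = \bigcup_n En n /\ forall n, closed (En n) /\ SOSD (En n).
Proof.
move=> [f [cf lf]].
have nf : nonexpansive f.
  by apply: lip_le1_nonexpansive => // x; rewrite lf lee_fin indicE; case: (_ \in _).
have oscE x : E x -> forall e, 0 < e -> exists2 d, 0 < d &
    forall r, 0 < r < d -> osc_at f (1 - e) r x.
  move=> Ex e e0; have [|d d0 Hd] := @lt_lip _ f x (1 - e).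
    by rewrite lf indicE mem_set// lte_fin/=; lra.
  by exists d => // r /Hd[y xy /ltW fy]; exists y.
(* Only the values 0 and 1 occur, so a positive lower bound on [lip f x] forces 1. *)
have Eosc x c d : 0 < c -> 0 < d -> (forall r, 0 < r < d -> osc_at f c r x) -> E x.
  move=> c0 d0 /(lip_ge d0); rewrite lf indicE; have [/set_mem//|_] := boolP (x \in E).
  by rewrite lee_fin leNgt c0.
have mosc h : measurable (osc_set f (1 / 16) h).
  by apply: closed_measurable; apply: osc_set_closed => //; lra.
(* For each of the countably many [osc_set] almost every point is as required by the density
   theorem, so one grid serves all [m]. *)
have [theta Htheta] := generic_grid (fun m => lebesgue_density (mosc (2 ^+ m)^-1)).
exists (good_from f theta); split; last first.
  move=> n; split; first exact: good_from_closed.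
  move=> x xF; apply: good_from_SOSD => //.
    by move=> m i k p pD; apply: density_sides => //; exact: Htheta.
  apply: oscE; apply: (@Eosc _ (1 / 1024) (2 ^+ n)^-1); [lra|by rewrite invr_gt0 exprn_gt0|].
  exact: good_from_osc xF.
apply/seteqP; split => x.
  move=> Ex; have [|d d0 Hd] := oscE x Ex (1 / 2); first by lra.
  have [n _ Hn] := exists_pow2_lt 0 d0.
  exists n => // m _; apply: subset_closure => k /andP[nk _].
  exists x => //; have [|y xy fy] := Hd (2 ^+ k)^-1.
    rewrite invr_gt0 exprn_gt0//= (le_lt_trans _ Hn)// lef_pV2 ?posrE ?exprn_gt0//.
    by rewrite ler_weXn2l ?ler1n.
  exists y => //; apply: (le_trans _ fy); rewrite ler_pM2r ?invr_gt0 ?exprn_gt0//.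
  by lra.
move=> [n _ xF]; apply: (@Eosc _ (1 / 1024) (2 ^+ n)^-1); [lra|by rewrite invr_gt0 exprn_gt0|].
exact: good_from_osc xF.
Qed.

End necessity.

(** * Zigzag functions *)

Section gdist.
Context {R : realType}.
Implicit Types (W : set R) (u v w : R).

Definition gdist W v : R := inf [set `|v - w| | w in W].

Lemma gdist_lbound W v : has_lbound [set `|v - w| | w in W].
Proof. by exists 0 => _ [w _ <-]. Qed.

Lemma gdist_le W v w : W w -> gdist W v <= `|v - w|.
Proof. by move=> Ww; apply: ge_inf; [exact: gdist_lbound|exists w]. Qed.

Lemma le_gdist W v c : W !=set0 -> (forall w, W w -> c <= `|v - w|) -> c <= gdist W v.
Proof.
move=> [w0 Ww0] H; apply: lb_le_inf; first by exists `|v - w0|, w0.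
by move=> _ [w Ww <-]; exact: H.
Qed.

Lemma gdist_ge0 W v : W !=set0 -> 0 <= gdist W v.
Proof. by move=> W0; exact: le_gdist. Qed.

Lemma gdist_nonexpansive W : W !=set0 -> nonexpansive (gdist W).
Proof.
move=> W0 u v; rewrite ler_norml; apply/andP; split.
  suff : gdist W v <= gdist W u + `|u - v| by lra.
  rewrite -lerBlDr; apply: le_gdist => // w /(gdist_le v).
  by have := ler_distD u v w; rewrite (distrC v u); lra.
suff : gdist W u <= gdist W v + `|u - v| by lra.
rewrite -lerBlDr; apply: le_gdist => // w /(gdist_le u).
by have := ler_distD v u w; lra.
Qed.

(** Across a gap of [W] the distance is a tent, hence linear of slope 1 or -1 on a short segment
    starting at [v]. *)
Lemma gdist_slope W v s L : W !=set0 -> s = 1 \/ s = -1 -> 0 < L ->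
  (forall w, W w -> s * (w - v) <= 0 \/ L <= s * (w - v)) ->
  exists2 eta, 0 < eta & forall u, 0 <= u <= eta ->
    `|gdist W (v + s * u) - gdist W v| = u.
Proof.
move=> W0 s1 L0 gap.
have ub u : 0 <= u -> `|gdist W (v + s * u) - gdist W v| <= u.
  move=> u0; apply: (le_trans (gdist_nonexpansive W0 _ _)).
  by case: s1 => ->; rewrite addrAC subrr add0r ?mul1r ?mulN1r ?normrN ger0_norm.
(* Either all points beyond the gap are farther than the distance by some [2 * eta], and the
   distance grows; or they come arbitrarily close to realising it, and it shrinks up to [L]. *)
have [far|near] := pselect (exists2 eta, 0 < eta &
    forall w, W w -> L <= s * (w - v) -> gdist W v + 2 * eta <= s * (w - v)).
  have [eta eta0 Heta] := far.
  exists eta => // u /andP[u0 ue]; apply/le_anti; rewrite ub//=.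
  rewrite (le_trans _ (ler_norm _))// lerBrDl; apply: le_gdist => // w Ww.
  have g0 := gdist_ge0 v W0.
  have := gdist_le v Ww; have := gap w Ww; have := Heta w Ww.
  case: s1 => ->; rewrite !(mul1r, mulN1r) => h1 h2 h3.
    case: h2 => h2.
      by move: h3; rewrite !ger0_norm; lra.
    by move: (h1 h2) => h4; rewrite ler0_norm; lra.
  case: h2 => h2.
    by move: h3; rewrite !ler0_norm; lra.
  by move: (h1 h2) => h4; rewrite ger0_norm; lra.
exists L => // u /andP[u0 uL]; apply/le_anti; rewrite ub//=.
rewrite distrC (le_trans _ (ler_norm _))// lerBrDr -lerBrDl.
apply/ler_addgt0Pr => e e0; rewrite leNgt; apply/negP => lt; apply: near.
exists (e / 2); first by lra.
move=> w Ww Lw; rewrite leNgt; apply/negP => lt2.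
have := gdist_le (v + s * u) Ww; case: s1 lt Lw lt2 => ->;
  rewrite !(mul1r, mulN1r) => lt Lw lt2.
  by rewrite ler0_norm; lra.
by rewrite ger0_norm; lra.
Qed.

End gdist.

Section cum.
Context {R : realType}.
Implicit Types (A B : set R) (x y : R).

(** A primitive of the indicator of [A], vanishing at 0; at each [y] one of the two terms is 0. *)
Definition cum A y := len A 0 y - len A y 0.

Lemma cumB A x y : measurable A -> x <= y -> cum A y - cum A x = len A x y.
Proof.
move=> mA xy; rewrite /cum.
have rev a b : b <= a -> len A a b = 0.
  rewrite le_eqVlt => /orP[/eqP->|ba]; last by apply: len_empty => // t; lra.
  by apply/le_anti; rewrite len_ge0 andbT -[leRHS](subrr a) len_le.
have [x0|x0] := leP 0 x.
  by rewrite (rev y 0) ?(le_trans x0)// (rev x 0)// (len_split mA x0 xy); lra.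
have [y0|y0] := leP 0 y.
  by rewrite (rev y 0)// (rev 0 x) ?ltW// (len_split mA (ltW x0) y0); lra.
by rewrite (rev 0 y) ?ltW// (rev 0 x) ?ltW// (len_split mA xy (ltW y0)); lra.
Qed.

End cum.

Section zigzag.
Context {R : realType}.
Variables (C C' : set R) (k : nat).
Hypotheses (cC : closed C) (cC' : closed C') (CC' : C `<=` C').
Implicit Types (x y z : R).

Let mC : measurable C := closed_measurable cC.
Let mC' : measurable C' := closed_measurable cC'.

(* The cap at 1 keeps the infimum meaningful for empty [A]. *)
Definition cdist (A : set R) y : R := inf ([set 1] `|` [set `|y - c| | c in A]).

Lemma cdist_lb (A : set R) y : has_lbound ([set 1] `|` [set `|y - c| | c in A]).
Proof. by exists 0 => _ [->|[c _ <-]]. Qed.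

Lemma cdist_le1 (A : set R) y : cdist A y <= 1.
Proof. by apply: ge_inf; [exact: cdist_lb|left]. Qed.

Lemma cdist_le (A : set R) y c : A c -> cdist A y <= `|y - c|.
Proof. by move=> Ac; apply: ge_inf; [exact: cdist_lb|right; exists c]. Qed.

Lemma le_cdist (A : set R) y c : c <= 1 -> (forall a, A a -> c <= `|y - a|) -> c <= cdist A y.
Proof.
by move=> c1 H; apply: lb_le_inf => [|_ [->|[a Aa <-]]//]; [exists 1; left|exact: H].
Qed.

Lemma cdist_ge0 (A : set R) y : 0 <= cdist A y.
Proof. exact: le_cdist. Qed.

Lemma cdist_anti (A B : set R) y : A `<=` B -> cdist B y <= cdist A y.
Proof. by move=> AB; apply: le_cdist => [|a /AB]; [exact: cdist_le1|exact: cdist_le]. Qed.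

Lemma cdist_dist (A : set R) x y : cdist A y <= cdist A x + `|x - y|.
Proof.
rewrite -lerBlDr; apply: le_cdist => [|a /(cdist_le y)]; first by have := cdist_le1 A y; have := normr_ge0 (x - y); lra.
by have := ler_distD x y a; rewrite (distrC y x); lra.
Qed.

Lemma cdist_gt0 (A : set R) x : closed A -> ~ A x -> 0 < cdist A x.
Proof.
move=> cA nAx; have : nbhs x (~` A) by apply: open_nbhs_nbhs; split => //; exact: closed_openC.
move=> /nbhs_ballP[d /= d0 Hd].
apply: (@lt_le_trans _ _ (Num.min d 1)); first by rewrite lt_min d0 ltr01.
apply: le_cdist => [|a Aa]; first by rewrite ge_min lexx orbT.
by rewrite ge_min leNgt; apply/orP; left; apply/negP => /Hd /(_ Aa).
Qed.

Definition height y := cdist C y / 2 ^+ k.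

Lemma pow2_gt0 (j : nat) : 0 < (2 ^+ j)^-1 :> R.
Proof. by rewrite invr_gt0 exprn_gt0. Qed.

Lemma pow2_le1 (j : nat) : (2 ^+ j)^-1 <= 1 :> R.
Proof. by rewrite invf_le1 ?exprn_gt0// exprn_ege1// ler1n. Qed.

Lemma height_le_cdist y : height y <= cdist C y.
Proof. by rewrite /height ler_piMr ?cdist_ge0// pow2_le1. Qed.

Lemma height_dist x y : height y <= height x + `|x - y|.
Proof.
have := ler_wpM2r (ltW (pow2_gt0 k)) (cdist_dist C x y).
rewrite mulrDl /height; have := ler_piMr (normr_ge0 (x - y)) (pow2_le1 k).
by lra.
Qed.

Lemma height_gt0 x : ~ C x -> 0 < height x.
Proof. by move=> nCx; rewrite divr_gt0 ?exprn_gt0// cdist_gt0. Qed.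

Lemma height_eq0 x : C x -> height x = 0.
Proof.
move=> Cx; apply/le_anti; rewrite (le_trans (height_le_cdist x)); last first.
  by rewrite (le_trans (cdist_le x Cx))// subrr normr0.
by rewrite divr_ge0 ?exprn_ge0// cdist_ge0.
Qed.

(* The mesh of the dyadic points kept is comparable to [height]: they come
   within [height y] of every [y], yet are locally finite off [C]. *)
Definition zeros := C `|`
  [set z | exists (i : int) (j : nat), z = i%:~R / 2 ^+ j /\ height z <= 3 / 2 ^+ j].

(** If [height y] lies between [2^-(j+1)] and [2^-j], the grid point of level [j+1] just left of [y]
    is near enough, and its height is at most [2 + 1] times [2^-(j+1)]: hence the 3 in [zeros]. *)
Lemma zeros_near y : exists2 z, zeros z & `|y - z| <= height y.
Proof.
have [Cy|nCy] := pselect (C y).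
  by exists y; [left|rewrite subrr normr0 height_eq0].
have h0 := height_gt0 nCy.
have [||j _ /andP[j1 j2]] := @dyadic_scale R 0 (height y) => //.
  by rewrite expr0 invr1 (le_trans (height_le_cdist y))// cdist_le1.
have [i] := grid_floor 0 j.+1 y; rewrite add0r => /andP[i1 i2].
have ss : (2 ^+ j)^-1 = 2 * (2 ^+ j.+1)^-1 :> R by rewrite exprS invfM mulrA divff// mul1r.
have yz : `|y - i%:~R / 2 ^+ j.+1| <= (2 ^+ j.+1)^-1 by rewrite ler_norml; lra.
exists (i%:~R / 2 ^+ j.+1); last by lra.
by right; exists i, j.+1; split => //; have := height_dist y (i%:~R / 2 ^+ j.+1); lra.
Qed.

(** Closer than [height x / 2] to [x] the height exceeds [height x / 2], so zeros there have
    [2^-j >= height x / 6] and all lie on the grid of level [J]. *)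
Lemma zeros_isolated x : ~ C x ->
  exists2 d, 0 < d & forall z, zeros z -> z <> x -> d <= `|x - z|.
Proof.
move=> nCx; have h0 := height_gt0 nCx.
have h6 : 0 < height x / 6 by lra.
have [J _ HJ] := exists_pow2_lt 0 h6.
have [i] := grid_floor 0 J x; rewrite add0r => /andP[i1 i2].
(* The floor at [- x] gives the next grid point strictly below [x], even when [x] is on the grid. *)
have [i'] := grid_floor 0 J (- x); rewrite add0r => /andP[i'1 i'2].
have J0 := pow2_gt0 J.
pose d := Num.min (height x / 2) (Num.min (i%:~R / 2 ^+ J + (2 ^+ J)^-1 - x)
  (i'%:~R / 2 ^+ J + (2 ^+ J)^-1 + x)).
exists d; first by rewrite !lt_min; lra.
move=> z Zz zx; rewrite leNgt; apply/negP.
rewrite !lt_min => /and3P[z1 z2 z3].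
have hz : height x / 2 < height z by have := height_dist z x; rewrite distrC; lra.
case: Zz => [/height_eq0|[m [j [zE hz3]]]]; first by lra.
have jJ : (j <= J)%N.
  rewrite leqNgt; apply/negP => Jj.
  have : (2 ^+ j)^-1 <= (2 ^+ J)^-1 :> R.
    by rewrite lef_pV2 ?posrE ?exprn_gt0// ler_weXn2l ?ler1n// ltnW.
  by lra.
pose m' := (m * 2 ^+ (J - j))%R.
have zE' : z = m'%:~R / 2 ^+ J.
  rewrite zE /m' -[in RHS](subnKC jJ); rewrite addKn intrM rmorphXn/= exprD invfM mulrACA.
  by rewrite [X in _ = _ * X](mulfV (_ : 2 ^+ (J - j) != 0 :> R)) ?mulr1 ?expf_neq0.
have step (a b : int) : a%:~R / 2 ^+ J < b%:~R / 2 ^+ J :> R ->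
    a%:~R / 2 ^+ J + (2 ^+ J)^-1 <= b%:~R / 2 ^+ J :> R.
  rewrite ltr_pM2r// ltr_int => ab.
  by rewrite -[X in _ + X <= _]mul1r -mulrDl ler_pM2r// -intrD1 ler_int lezD1.
have [zx'|xz|//] := ltgtP z x; last first.
  have := step i m'; rewrite -zE' => /(_ ltac:(lra)).
  by move: z2; rewrite ltr0_norm; lra.
have := step i' (- m'); rewrite mulrNz mulNr -zE' => /(_ ltac:(lra)).
by move: z3; rewrite gtr0_norm; lra.
Qed.

(** A primitive of the indicator of [C'] minus [C]. *)
Definition gap y := cum C' y - cum C y.

Lemma gapB x y : x <= y -> gap y - gap x = len C' x y - len C x y.
Proof. by move=> xy; rewrite /gap -!cumB//; lra. Qed.

Lemma gap_itv x y : x <= y -> 0 <= gap y - gap x <= y - x.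
Proof.
move=> xy; rewrite gapB//; apply/andP; split.
  by rewrite subr_ge0; apply: len_sub => // t /CC'.
by have := len_le mC' xy; have := len_ge0 C x y; lra.
Qed.

Lemma gap_nonexpansive : nonexpansive gap.
Proof.
by apply: nonexpansiveP => x y /gap_itv/andP[h1 h2]; rewrite ger0_norm.
Qed.

(* The distance from [y] to [zeros], measured by the part of [C' `\` C] in
   between: slope [+-1] on [C' `\` C], flat elsewhere. *)
Definition zigzag y := gdist (gap @` zeros) (gap y).

Lemma gap_zeros0 : gap @` zeros !=set0.
Proof. by have [z Zz _] := zeros_near 0; exists (gap z), z. Qed.

Lemma zigzag_ge0 y : 0 <= zigzag y.
Proof. exact/gdist_ge0/gap_zeros0. Qed.

Lemma zigzag_le y : zigzag y <= height y.
Proof.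
have [z Zz yz] := zeros_near y; apply: le_trans yz.
apply: le_trans (gap_nonexpansive y z).
by apply: gdist_le; exists z.
Qed.

Lemma zigzagB x y : x <= y -> `|zigzag y - zigzag x| <= gap y - gap x.
Proof.
move=> xy; apply: (le_trans (gdist_nonexpansive gap_zeros0 _ _)).
by rewrite ger0_norm//; case/andP: (gap_itv xy).
Qed.

(** Zeros are isolated at [x], so on each side where [gap] is not constant up to [d] their images
    leave an interval next to [gap x] free, and [gdist_slope] applies. The sign [s] treats both
    sides at once. *)
Lemma zigzag_slope x : ~ C x -> exists2 d, 0 < d & forall r, 0 <= r <= d ->
  `|zigzag (x + r) - zigzag x| = gap (x + r) - gap x /\
  `|zigzag (x - r) - zigzag x| = gap x - gap (x - r).
Proof.
move=> /zeros_isolated[d d0 Hd].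
have main s : s = 1 \/ s = -1 -> exists2 d', 0 < d' & forall r, 0 <= r <= d' ->
    `|zigzag (x + s * r) - zigzag x| = s * (gap (x + s * r) - gap x).
  move=> s1.
  have mono r r' : 0 <= r -> r <= r' ->
      0 <= s * (gap (x + s * r') - gap (x + s * r)) <= r' - r.
    move=> r0 rr'; case: s1 => ->; rewrite !(mul1r, mulN1r).
      have xx : x + r <= x + r' by lra.
      by have := gap_itv xx; lra.
    have xx : x - r' <= x - r by lra.
    by have := gap_itv xx; lra.
  have m0 r : 0 <= r -> 0 <= s * (gap (x + s * r) - gap x) <= r.
    by move=> /(mono 0 r (lexx 0)); rewrite mulr0 addr0 subr0.
  pose L := s * (gap (x + s * d) - gap x).
  have [L0|L0] := leP L 0.
    exists d => // r /andP[r0 rd].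
    have h : s * (gap (x + s * r) - gap x) = 0.
      apply/le_anti; have /andP[-> _] := m0 r r0; rewrite andbT (le_trans _ L0)//.
      by have := mono r d r0 rd; rewrite /L; lra.
    have h' : gap (x + s * r) = gap x.
      by move: h; case: s1 => ->; rewrite !(mul1r, mulN1r); lra.
    by rewrite h /zigzag h' subrr normr0.
  have [|eta eta0 Heta] := gdist_slope (v := gap x) gap_zeros0 s1 L0.
    move=> _ [z Zz <-].
    have [sz|sz] := leP (s * (z - x)) 0.
      left; have := gap_itv; case: s1 sz => ->; rewrite !(mul1r, mulN1r) => sz gi.
        have zx : z <= x by lra.
        by have := gi _ _ zx; lra.
      have zx : x <= z by lra.
      by have := gi _ _ zx; lra.
    right; have zx : z <> x by move=> zx; rewrite zx subrr mulr0 ltxx in sz.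
    have dz : d <= s * (z - x).
      have := Hd z Zz zx; case: s1 sz => ->; rewrite !(mul1r, mulN1r) => sz.
        by rewrite ltr0_norm; lra.
      by rewrite gtr0_norm; lra.
    have := mono d (s * (z - x)) (ltW d0) dz.
    have -> : x + s * (s * (z - x)) = z by case: s1 => ->; lra.
    by rewrite /L; lra.
  exists eta => // r /andP[r0 re].
  have /andP[g0 gr] := m0 r r0.
  have := Heta (s * (gap (x + s * r) - gap x)).
  rewrite g0 (le_trans gr re) => /(_ isT).
  have ss : s * s = 1 by case: s1 => ->; rewrite ?mulrNN mul1r.
  by rewrite [gap x + _](_ : _ = gap (x + s * r))// mulrA ss mul1r addrC subrK.
have [d1 d10 H1] := main 1 (or_introl erefl).
have [d2 d20 H2] := main (-1) (or_intror erefl).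
exists (Num.min d1 d2); first by rewrite lt_min d10.
move=> r /andP[r0]; rewrite le_min => /andP[r1 r2]; split.
  by have := H1 r; rewrite !mul1r r0 r1 => ->.
by have := H2 r; rewrite !mulN1r r0 r2 => -> //; rewrite opprD opprK addrC.
Qed.

End zigzag.

(** * The sum of the zigzags *)

Section zigzag_sum.
Context {R : realType}.
Variable C : nat -> set R.
Hypotheses (C0 : C 0 = set0) (cC : forall n, closed (C n))
  (incC : forall n, C n `<=` C n.+1).
Implicit Types (x y r e : R) (n k N : nat).

Let mC n : measurable (C n).
Proof. exact: closed_measurable. Qed.

Lemma incC_le n m : (n <= m)%N -> C n `<=` C m.
Proof.
move=> /subnK <-; elim: (m - n)%N => [|d IH]; first by rewrite add0n.
by apply: (subset_trans IH); rewrite addSn.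
Qed.

Let zz k y := zigzag (C k) (C k.+1) k y.
Let gp k y := gap (C k) (C k.+1) y.

Definition zigzag_sum y := lim (series (fun k => zigzag (C k) (C k.+1) k y) @ \oo).

Lemma sum_pow2 n N : (n <= N)%N ->
  \sum_(n <= k < N) (2 ^+ k)^-1 <= 2 / 2 ^+ n :> R.
Proof.
move=> nN; suff : \sum_(n <= k < N) (2 ^+ k)^-1 <= 2 / 2 ^+ n - 2 / 2 ^+ N :> R.
  by have := pow2_gt0 (R := R) N; lra.
rewrite -[leRHS]opprB -(telescope_sumr (fun k => 2 / 2 ^+ k : R) nN) -sumrN.
apply: ler_sum => k _.
have -> : (2 ^+ k)^-1 = 2 * (2 ^+ k.+1)^-1 :> R by rewrite exprS invfM mulrA divff// mul1r.
lra.
Qed.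

Lemma zigzag_sum_cvg y :
  series (fun k => zigzag (C k) (C k.+1) k y) @ \oo --> zigzag_sum y.
Proof.
apply: (@series_le_cvg _ _ (geometric 1 2^-1)).
- by move=> k; exact: zigzag_ge0.
- by move=> k; rewrite /= mul1r exprn_ge0// invr_ge0.
- move=> k; apply: (le_trans (zigzag_le k (@cC k) (@cC k.+1) (@incC k) y)).
  by rewrite /height /= mul1r exprVn ler_piMl ?cdist_le1// ltW// pow2_gt0.
- by apply: is_cvg_geometric_series; rewrite ger0_norm; lra.
Qed.

Lemma zigzag_sumB_cvg x y :
  `|\sum_(0 <= k < N) (zz k y - zz k x)| @[N --> \oo] --> `|zigzag_sum y - zigzag_sum x|.
Proof.
under eq_fun do rewrite sumrB.
exact: cvg_norm (cvgB (@zigzag_sum_cvg y) (@zigzag_sum_cvg x)).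
Qed.

Lemma zigzag_sumB_le x y c N0 :
  (forall N, (N0 <= N)%N -> `|\sum_(0 <= k < N) (zz k y - zz k x)| <= c) ->
  `|zigzag_sum y - zigzag_sum x| <= c.
Proof.
move=> H; apply: (cvgr_to_le (@zigzag_sumB_cvg x y)).
by exists N0 => // N; exact: H.
Qed.

Lemma zigzag_sumB_ge x y c N0 :
  (forall N, (N0 <= N)%N -> c <= `|\sum_(0 <= k < N) (zz k y - zz k x)|) ->
  c <= `|zigzag_sum y - zigzag_sum x|.
Proof.
move=> H; apply: (cvgr_to_ge (@zigzag_sumB_cvg x y)).
by exists N0 => // N; exact: H.
Qed.

(** The increments telescope in the measures of the [C k]; all zigzags together share this budget of
    variation. *)
Lemma gp_sum x y N : x <= y -> \sum_(0 <= k < N) (gp k y - gp k x) <= y - x.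
Proof.
move=> xy; under eq_bigr do rewrite gapB//.
rewrite (telescope_sumr (fun k => len (C k) x y))//.
by have := len_le (mC N) xy; have := len_ge0 (C 0) x y; lra.
Qed.

Lemma zzB k x y : x <= y -> `|zz k y - zz k x| <= gp k y - gp k x.
Proof. by move=> xy; apply: zigzagB. Qed.

Lemma zigzag_sum_nonexpansive : nonexpansive zigzag_sum.
Proof.
apply: nonexpansiveP => x y xy; apply: (@zigzag_sumB_le _ _ _ 0) => N _.
apply: (le_trans (ler_norm_sum _ _ _)); apply: (le_trans _ (gp_sum N xy)).
by apply: ler_sum => k _; exact: zzB.
Qed.

(** If zigzag [n] uses its whole share [g] of the budget [y - x], the others together vary by at
    most [y - x - g] and can cancel no more. *)
Lemma zigzag_sum_ge n x y : x <= y -> `|zz n y - zz n x| = gp n y - gp n x ->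
  2 * (gp n y - gp n x) - (y - x) <= `|zigzag_sum y - zigzag_sum x|.
Proof.
move=> xy slope; apply: (@zigzag_sumB_ge _ _ _ n.+1) => N nN.
have := gp_sum N xy; rewrite !big_mkord (bigD1 (Ordinal nN))//= => gsum.
rewrite (bigD1 (Ordinal nN))//=; apply: le_trans (lerB_normD _ _).
rewrite slope.
have : `|\sum_(i < N | i != Ordinal nN) (zz i y - zz i x)| <=
    \sum_(i < N | i != Ordinal nN) (gp i y - gp i x).
  by apply: (le_trans (ler_norm_sum _ _ _)); apply: ler_sum => k _; exact: zzB.
lra.
Qed.

(** Near [x] the closed set [C n] is absent, so the share of zigzag [n] is the measure of [C n.+1]
    alone, nearly [r] on one side. *)
Lemma lip_zigzag_sum_in n x : C n.+1 x -> ~ C n x ->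
  strongly_one_sided_dense_at (C n.+1) x -> lip zigzag_sum x = 1%:E.
Proof.
move=> Cx nCx /(SOSD_atP _ (mC n.+1)) H; apply/le_anti/andP; split.
  apply: lip_le => d d0; exists (d / 2); first by lra.
  move=> y xy; rewrite mul1r; apply: le_trans xy.
  exact: zigzag_sum_nonexpansive.
apply/lee_subgt0Pr => e e0; rewrite -EFinB.
(* Half of [e], since [zigzag_sum_ge] doubles the loss. *)
have e20 : 0 < e / 2 by lra.
have [d1 d10 Hd1] := H _ e20.
have [d2 d20 Hd2] := zigzag_slope n (@cC n) (@cC n.+1) (@incC n) nCx.
have : nbhs x (~` C n) by apply: open_nbhs_nbhs; split => //; exact: closed_openC.
move=> /nbhs_ballP[d3 /= d30 Hd3].
apply: (@lip_ge _ _ _ _ (Num.min d1 (Num.min d2 d3))); first by rewrite !lt_min d10 d20.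
move=> r; rewrite !lt_min => /and4P[r0 r1 r2 r3].
have [|g1 g2] := Hd2 r; first by lra.
have xr : x <= x + r by lra.
have rx : x - r <= x by lra.
have noC t : `|x - t| <= r -> ~ C n t by move=> xt; apply: Hd3; rewrite /ball/=; lra.
have [|h|h] := Hd1 r; first by lra.
  exists (x - r); first by rewrite subKr gtr0_norm.
  have sl : `|zz n x - zz n (x - r)| = gp n x - gp n (x - r) by rewrite distrC.
  apply: le_trans (zigzag_sum_ge rx sl).
  rewrite /gp gapB// (@len_empty _ (C n))//; first lra.
  by move=> t xt; apply: noC; rewrite ler_norml; lra.
exists (x + r); first by rewrite opprD addNKr normrN gtr0_norm.
rewrite distrC; apply: le_trans (zigzag_sum_ge xr g1).
rewrite /gp gapB// (@len_empty _ (C n))//; first lra.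
by move=> t xt; apply: noC; rewrite ler_norml; lra.
Qed.

Lemma zz_const n k x y : (k < n)%N -> x <= y ->
  (forall t, x <= t <= y -> ~ C n t) -> zz k y = zz k x.
Proof.
move=> kn xy H; have := zzB k xy; rewrite /gp gapB//.
have e j : (j <= n)%N -> len (C j) x y = 0.
  by move=> jn; apply: len_empty => // t xty /(incC_le jn); exact: H.
by rewrite !e// 1?ltnW// subrr normr_le0 subr_eq0 => /eqP.
Qed.

(** Zigzags before [n] are constant between [x] and [y]; later ones are bounded by their heights at
    both points, a geometric tail. *)
Lemma zigzag_sumB_out n x y : (forall t, `|x - t| <= `|x - y| -> ~ C n t) ->
  `|zigzag_sum y - zigzag_sum x| <= 2 / 2 ^+ n * (2 * cdist (C n) x + `|x - y|).
Proof.
move=> H; apply: (@zigzag_sumB_le _ _ _ n) => N nN.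
have zh k t : zz k t <= height (C k) k t by exact: zigzag_le.
have z0 k t : 0 <= zz k t by exact: zigzag_ge0.
have rho0 := cdist_ge0 (C n) x.
have b0 : 0 <= 2 * cdist (C n) x + `|x - y| by rewrite addr_ge0// mulr_ge0.
rewrite (big_cat_nat _ nN)//= [X in X + _]big_nat [X in X + _]big1 ?add0r => [|k kn]; last first.
  have [xy|/ltW yx] := leP x y.
    rewrite (zz_const kn xy) ?subrr// => t txy; apply: H.
    by rewrite !ler0_norm; lra.
  rewrite (zz_const kn yx) ?subrr// => t txy; apply: H.
  by rewrite !ger0_norm; lra.
apply: (le_trans (ler_norm_sum _ _ _)).
apply: (@le_trans _ _ (\sum_(n <= k < N) ((2 ^+ k)^-1 * (2 * cdist (C n) x + `|x - y|)))).
  rewrite !big_nat; apply: ler_sum => k /andP[nk _].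
  have kk t : height (C k) k t <= cdist (C n) t * (2 ^+ k)^-1.
    by rewrite /height ler_pM2r ?pow2_gt0// cdist_anti//; exact: incC_le.
  have : cdist (C n) y * (2 ^+ k)^-1 <= (cdist (C n) x + `|x - y|) * (2 ^+ k)^-1.
    by rewrite ler_pM2r ?pow2_gt0// cdist_dist.
  have := kk x; have := kk y; have := zh k x; have := zh k y.
  have := z0 k x; have := z0 k y; rewrite ler_norml; lra.
by rewrite -mulr_suml ler_wpM2r// sum_pow2.
Qed.

Lemma lip_zigzag_sum_out x : (forall n, ~ C n x) -> lip zigzag_sum x = 0%:E.
Proof.
move=> nCx; apply/le_anti/andP; split; last first.
  apply: (@lip_ge _ _ _ _ 1) => // r /andP[r0 _].
  by exists x; rewrite subrr normr0 ?mul0r// ltW.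
apply/lee_addgt0Pr => e e0; rewrite add0e; apply: lip_le => d d0.
pose m := Num.min d 1.
have m0 : 0 < m by rewrite lt_min d0 ltr01.
have md : m <= d by rewrite ge_min lexx.
have m1 : m <= 1 by rewrite ge_min lexx orbT.
(* [n] depends on [e] and [m] only, so it is fixed before the distance from [x] to [C n] is known.
   If that distance is [2 * r], the bound is [2 * (e * m / 12) * (5 * r) <= e * r]; if [r = m / 2],
   it is [2 * (e * m / 12) * 3 = e * r]. *)
have em0 : 0 < e * m / 12 by rewrite !mulr_gt0.
have [n _ Hn] := exists_pow2_lt 0 em0.
have rho0 : 0 < cdist (C n) x by exact: cdist_gt0.
pose r := Num.min (cdist (C n) x / 2) (m / 2).
have r0 : 0 < r by rewrite lt_min; lra.
have r1 : r <= cdist (C n) x / 2 by rewrite ge_min lexx.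
have r2 : r <= m / 2 by rewrite ge_min lexx orbT.
have em : e * m <= e by rewrite ger_pMr.
have p0 : 0 < (2 ^+ n)^-1 :> R := pow2_gt0 n.
exists r; first by lra.
move=> y xy; rewrite distrC; apply: le_trans (zigzag_sumB_out (n := n) _) _.
  by move=> t xt /(cdist_le x); lra.
apply: (@le_trans _ _ (2 / 2 ^+ n * (2 * cdist (C n) x + r))).
  by rewrite ler_pM2l ?lerD2l//; lra.
have [h|h] := leP (cdist (C n) x / 2) (m / 2).
  have rE : cdist (C n) x = 2 * r by rewrite /r min_l// mulrC divfK.
  rewrite rE; apply: (@le_trans _ _ (2 * (e * m / 12) * (2 * (2 * r) + r))).
    by rewrite ler_pM2r; lra.
  have : e * m * r <= e * r by rewrite ler_pM2r.
  have : 0 < e * m * r by rewrite !mulr_gt0.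
  lra.
have rE : r = m / 2 by rewrite /r min_r// ltW.
apply: (@le_trans _ _ (2 * (e * m / 12) * 3)).
  rewrite ler_pM ?addr_ge0//; try lra.
  by have := cdist_le1 (C n) x; lra.
by rewrite rE; lra.
Qed.

Lemma zigzag_sum_lip1 : (forall n, SOSD (C n)) -> lip1 (\bigcup_n C n).
Proof.
move=> sC; exists zigzag_sum; split.
  exact: nonexpansive_continuous zigzag_sum_nonexpansive.
move=> x; rewrite indicE; have [/set_mem[n _]|nx] := boolP (x \in _); last first.
  apply: lip_zigzag_sum_out => n Cnx; move: nx; rewrite notin_setE; apply.
  by exists n.
elim: n => [|n IH] Cx; first by rewrite C0 in Cx.
have [Cnx|nCx] := pselect (C n x); first exact: IH.
exact: (lip_zigzag_sum_in Cx nCx (sC _ _ Cx)).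
Qed.

End zigzag_sum.

(** Finite unions of the [En] stay strongly one-sided dense, because enlarging a set preserves
    density at its old points. *)
Lemma bigcup_SOSD_lip1 (R : realType) (En : nat -> set R) :
  (forall n, closed (En n) /\ SOSD (En n)) -> lip1 (\bigcup_n En n).
Proof.
move=> H; pose C n := \big[setU/set0]_(i < n) En i.
have CS n : C n.+1 = C n `|` En n by rewrite /C big_ord_recr.
have C0 : C 0 = set0 by rewrite /C big_ord0.
have cC n : closed (C n).
  elim: n => [|n IH]; first by rewrite C0; exact: closed0.
  by rewrite CS; apply: closedU => //; case: (H n).
have inc n : C n `<=` C n.+1 by rewrite CS; exact: subsetUl.
have sC n : SOSD (C n).
  elim: n => [|n IH] x; first by rewrite C0.
  have [cE sE] := H n.
  rewrite {1}CS => -[Cx|Ex].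
    apply: SOSD_at_sub (IH x Cx); [exact: closed_measurable..|exact: inc].
  apply: SOSD_at_sub (sE x Ex); [exact: closed_measurable..|].
  by rewrite CS; exact: subsetUr.
have -> : \bigcup_n En n = \bigcup_n C n.
  rewrite -(bigcup_bigsetU_bigcup En); apply/seteqP; split => x [n _ xn].
    by exists n.+1.
  by case: n xn => [|n] xn; [rewrite C0 in xn|exists n].
exact: zigzag_sum_lip1.
Qed.

Theorem theorem2p2 (R : realType) (E : set R) :
  lip1 E <->
  exists En : nat -> set R,
    E = \bigcup_n En n /\ forall n, closed (En n) /\ SOSD (En n).
Proof.
split; first exact: lip1_bigcup_SOSD.
by move=> [En [-> H]]; exact: bigcup_SOSD_lip1.
Qed.
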